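(* Both of the following hold. (1) If $G$ is a graph of order $n$ and independence number $\alpha$, and $G$ is not isomorphic to $H_{n,\alpha}$, then $$\eta(G) < \eta(H_{n,\alpha}).$$ (2) If $G$ is a graph of order $n$ and vertex cover number $\beta$, and $G$ is not isomorphic to $H_{n,n-\beta}$, then $$\eta(G) < \eta(H_{n,n-\beta}).$$
   Context: All graphs are finite and simple (undirected, no loops or multiple edges), have at least one vertex, and are not assumed connected. The order of $G$ is $|V(G)|$. For a graph $G$, $\eta(G)$ denotes the number of connected induced subgraphs of $G$, i.e. the number of nonempty subsets $S\subseteq V(G)$ such that the subgraph of $G$ induced by $S$ is connected. The independence number of $G$ is the maximum size of a set of pairwise nonadjacent vertices of $G$. A vertex cover of $G$ is a set of vertices containing at least one endvertex of every edge of $G$; the vertex cover number of $G$ is the minimum size of a vertex cover. For integers $1\le \alpha\le n$, the graph $H_{n,\alpha}$ is obtained by taking disjoint copies of the complete graph $K_{n-\alpha}$ and of the edgeless graph $\overline{K_\alpha}$ on $\alpha$ vertices, then adding an edge between every vertex of $K_{n-\alpha}$ and every vertex of $\overline{K_\alpha}$ (when $\alpha=n$, $H_{n,n}=\overline{K_n}$). *)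

(* Defs.v *)
From mathcomp Require Import all_boot.

Set Implicit Arguments.
Unset Strict Implicit.
Unset Printing Implicit Defensive.

Record sgraph := SGraph {
  vertex :> finType;
  adj : rel vertex;
  adj_sym : symmetric adj;
  adj_irr : irreflexive adj }.

Definition isomorphic (G H : sgraph) : Prop :=
  exists f : G -> H, bijective f /\ forall x y : G, adj (f x) (f y) = adj x y.

Section Induced.
Variables (G : sgraph) (S : {set G}).

Definition induced_adj : rel {x : G | x \in S} :=
  [rel u v | adj (val u) (val v)].

Lemma induced_adj_sym : symmetric induced_adj.
Proof. by move=> u v; exact: adj_sym. Qed.

Lemma induced_adj_irr : irreflexive induced_adj.
Proof. by move=> u; exact: adj_irr. Qed.

Definition induced : sgraph := SGraph induced_adj_sym induced_adj_irr.
End Induced.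

(* Holds of the graph without vertices, so [eta] asks for nonemptiness
   separately. *)
Definition connected (G : sgraph) : bool :=
  [forall x : G, forall y : G, connect (@adj G) x y].

Definition eta (G : sgraph) : nat :=
  #|[set S : {set G} | (S != set0) && connected (induced S)]|.

Definition independent (G : sgraph) (S : {set G}) : bool :=
  [forall x in S, forall y in S, ~~ adj x y].

Definition independence_number (G : sgraph) : nat :=
  \max_(S : {set G} | independent S) #|S|.

Definition vertex_cover (G : sgraph) (S : {set G}) : bool :=
  [forall x : G, forall y : G, adj x y ==> (x \in S) || (y \in S)].

(* [setT] is a vertex cover, so the minimum is taken over a nonempty family. *)
Definition vertex_cover_number (G : sgraph) : nat :=
  #|[arg min_(S < [set: G] | vertex_cover S) #|S| ]|.

Section Complete.
Variable m : nat.

Definition complete_adj : rel 'I_m := [rel i j | i != j].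

Lemma complete_adj_sym : symmetric complete_adj.
Proof. by move=> i j; rewrite /complete_adj /= eq_sym. Qed.

Lemma complete_adj_irr : irreflexive complete_adj.
Proof. by move=> i; rewrite /complete_adj /= eqxx. Qed.

Definition complete : sgraph := SGraph complete_adj_sym complete_adj_irr.
End Complete.

Section Edgeless.
Variable m : nat.

Definition edgeless_adj : rel 'I_m := [rel _ _ | false].

Lemma edgeless_adj_sym : symmetric edgeless_adj.
Proof. by []. Qed.

Lemma edgeless_adj_irr : irreflexive edgeless_adj.
Proof. by []. Qed.

Definition edgeless : sgraph := SGraph edgeless_adj_sym edgeless_adj_irr.
End Edgeless.

Section Join.
Variables G H : sgraph.

Definition join_adj : rel (G + H)%type := fun u v =>
  match u, v with
  | inl x, inl y => adj x y
  | inr x, inr y => adj x y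
  | _, _ => true
  end.

Lemma join_adj_sym : symmetric join_adj.
Proof. by move=> [x|x] [y|y] //=; exact: adj_sym. Qed.

Lemma join_adj_irr : irreflexive join_adj.
Proof. by move=> [x|x]; exact: adj_irr. Qed.

Definition join : sgraph := SGraph join_adj_sym join_adj_irr.
End Join.

(* The graph H_{n,alpha}, meaningful for 1 <= alpha <= n: the subtraction is
   truncated. *)
Definition Hgraph (n alpha : nat) : sgraph :=
  join (complete (n - alpha)) (edgeless alpha).

(* Main.v *)
Require Import Defs.
From mathcomp Require Import all_boot.

Set Implicit Arguments.
Unset Strict Implicit.
Unset Printing Implicit Defensive.

(** The complement of a vertex cover is independent, so in both parts [G] has
    an independent set of size [k], where [k] is the second parameter of the
    comparison graph. Matching this set with the edgeless side of [H_{n,k}]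
    identifies [G] with a spanning subgraph of [H_{n,k}], so every connected
    vertex set of [G] is connected in [H_{n,k}]. If [G] is not isomorphic to
    [H_{n,k}], an edge of [H_{n,k}] is missing in [G], and its two ends form a
    set that is connected in [H_{n,k}] but not in [G]. *)

Lemma connect_homo (T T' : finType) (e : rel T) (e' : rel T') (f : T -> T') :
  {homo f : x y / e x y >-> e' x y} ->
  {homo f : x y / connect e x y >-> connect e' x y}.
Proof.
move=> ef x y /connectP[p ep ->]; apply/connectP.
by exists (map f p); rewrite ?last_map ?(homo_path ef).
Qed.

(** [f] restricts to a homomorphism [g] from [induced S] onto [induced (f @: S)]; walks map to
    walks, and surjectivity of [g] lets every pair of vertices be lifted. *)
Lemma connected_imset (G H : sgraph) (f : G -> H) (S : {set G}) :
  {homo f : x y / adj x y} ->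
  connected (induced S) -> connected (induced (f @: S)).
Proof.
move=> fadj /forallP conS.
pose g (u : induced S) : induced (f @: S) := Sub (f (val u)) (imset_f f (valP u)).
have g_homo : {homo g : u v / adj u v} by move=> u v; exact: fadj.
have g_onto u : exists v, g v = u.
  have /imsetP[x xS ux] := valP u.
  by exists (Sub x xS); apply: val_inj.
apply/forallP=> u; apply/forallP=> v.
have [[u' <-] [v' <-]] := (g_onto u, g_onto v).
exact: connect_homo g_homo _ _ (forallP (conS u') v').
Qed.

Lemma connected_pair (G : sgraph) (x y : G) :
  x != y -> connected (induced [set x; y]) = adj x y.
Proof.
move=> xDy; pose P := induced [set x; y].
pose u : P := Sub x (set21 x y); pose v : P := Sub y (set22 x y).
have uv w : w = u \/ w = v.
  by have /set2P[wE|wE] := valP w; [left | right]; apply: val_inj.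
apply/idP/idP => [/forallP/(_ u)/forallP/(_ v)/connectP[[|w p] /=]|adjxy].
- by move=> _ /(congr1 val)/= yx; rewrite yx eqxx in xDy.
(* The first step of a walk from [x] cannot stay at [x], so it goes to [y] and is the edge
   sought. *)
- by case/andP; have [->|->] := uv w; rewrite /induced_adj /= ?adj_irr.
apply/forallP=> a; apply/forallP=> b.
by have [->|->] := uv a; have [->|->] := uv b;
  rewrite ?connect0 // connect1 //= /induced_adj /= // adj_sym.
Qed.

Lemma eta_lt_bij_homo (G H : sgraph) (f : G -> H) :
  bijective f -> {homo f : x y / adj x y} -> ~ isomorphic G H ->
  eta G < eta H.
Proof.
move=> f_bij fadj nisoGH; have f_inj := bij_inj f_bij.
have [x [y [nadj_xy adj_fxy]]] :
    exists x y, ~~ adj x y /\ adj (f x) (f y).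
  have [/existsP[x /existsP[y /andP[]]]|nex] :=
    boolP [exists x, exists y, ~~ adj x y && adj (f x) (f y)].
    by exists x, y.
  case: nisoGH; exists f; split=> // x y; apply/idP/idP => [fxy|/fadj//].
  by apply: contraNT nex => nxy; apply/existsP; exists x; apply/existsP;
    exists y; rewrite nxy.
have xDy : x != y.
  by apply: contraTneq adj_fxy => ->; rewrite adj_irr.
(* Replacing the connected sets of [G] by their images puts both families in [{set H}], where strict
   inclusion suffices. *)
rewrite /eta -(card_imset _ (imset_inj f_inj)); apply: proper_card.
apply/properP; split.
  apply/subsetP=> _ /imsetP[S /[!inE]/andP[S0 conS] ->].
  by rewrite imset_eq0 S0 connected_imset.
exists (f @: [set x; y]).
  rewrite inE imset_eq0 -card_gt0 cards2 /= imsetU1 imset_set1.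
  by rewrite connected_pair ?(inj_eq f_inj).
rewrite (mem_imset _ _ (imset_inj f_inj)) inE connected_pair //.
by rewrite (negPf nadj_xy) andbF.
Qed.

Lemma eta_lt_independent (G : sgraph) (I : {set G}) :
  independent I -> ~ isomorphic G (Hgraph #|G| #|I|) ->
  eta G < eta (Hgraph #|G| #|I|).
Proof.
move=> /forall_inP indI; set H := Hgraph _ _.
have cardC : #|G| - #|I| = #|~: I| by rewrite [RHS]cardsCs setCK.
(* The map is built from [H] to [G], where [enum_val] lists [~: I] and [I] directly; its inverse is
   the homomorphism wanted. *)
pose h (u : H) : G := match u with
  | inl i => enum_val (cast_ord cardC i)
  | inr j => enum_val j
  end.
have hl i : h (inl i) \notin I.
  by have := enum_valP (cast_ord cardC i); rewrite inE.
have hr j : h (inr j) \in I by exact: enum_valP.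
have h_inj : injective h.
  move=> [i|j] [i'|j'] E.
  - by have /cast_ord_inj -> := enum_val_inj E.
  - by have := hl i; rewrite E hr.
  - by have := hl i'; rewrite -E hr.
  - by rewrite (enum_val_inj E).
have h_bij : bijective h.
  by apply: inj_card_bij => //; rewrite card_sum !card_ord subnK ?max_card.
(* Nonadjacent vertices of [H] are either equal clique vertices or both on the edgeless side, which
   [h] sends into [I]. *)
have hadj u v : adj (h u) (h v) -> adj u v.
  case: u v => [i|j] [i'|j'] //.
    by apply: contraTneq => ->; rewrite adj_irr.
  by apply: contraTT => _; exact: (forall_inP (indI _ (hr j))).
have [f hK fK] := h_bij.
apply: eta_lt_bij_homo => [|x y xy]; first by exists h; [exact: fK | exact: hK].
by apply: hadj; rewrite !fK.
Qed.

Lemma independence_number_witness (G : sgraph) :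
  exists2 I : {set G}, independent I & #|I| = independence_number G.
Proof.
(* An independent set must exist for the maximum to be attained. *)
have ind0 : independent (set0 : {set G}).
  by apply/forall_inP=> x; rewrite inE.
rewrite /independence_number (bigmax_eq_arg set0) //.
by case: arg_maxnP => // I indI _; exists I.
Qed.

Lemma vertex_cover_number_witness (G : sgraph) :
  exists2 I : {set G}, independent I & #|I| = #|G| - vertex_cover_number G.
Proof.
rewrite /vertex_cover_number; case: arg_minnP => [|S covS _].
  by apply/forallP=> x; apply/forallP=> y; rewrite inE implybT.
exists (~: S); last by rewrite cardsCs setCK.
apply/forall_inP=> x /[!inE] xS; apply/forall_inP=> y /[!inE] yS.
have /forallP/(_ x)/forallP/(_ y) := covS.
by rewrite (negPf xS) (negPf yS) implybF.
Qed.

Theorem proposition2p2 :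
  (forall (G : sgraph) (n alpha : nat),
     0 < #|G| -> #|G| = n -> independence_number G = alpha ->
     ~ isomorphic G (Hgraph n alpha) ->
     eta G < eta (Hgraph n alpha))
  /\
  (forall (G : sgraph) (n beta : nat),
     0 < #|G| -> #|G| = n -> vertex_cover_number G = beta ->
     ~ isomorphic G (Hgraph n (n - beta)) ->
     eta G < eta (Hgraph n (n - beta))).
Proof.
split=> G n k _ <- <-.
  by have [I indI <-] := independence_number_witness G;
    exact: eta_lt_independent.
by have [I indI <-] := vertex_cover_number_witness G;
  exact: eta_lt_independent.
Qed.
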